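(* Let $A$, $B$ and $C$ be finite-dimensional vector spaces over a field $k$, and let $f:A\times B\to C$ be a $k$-bilinear map such that every nonzero element $a\in A$ induces a nonzero map $f(a,-):B\to C$, but such that this property is lost on restriction to any proper subspace of $B$, and likewise on composition with the map from $C$ to any proper homomorphic image of $C$. That is: for every proper subspace $B_0\subsetneq B$ there is a nonzero $a\in A$ with $f(a,b)=0$ for all $b\in B_0$; and for every nonzero subspace $C_0\subseteq C$ there is a nonzero $a\in A$ with $f(a,b)\in C_0$ for all $b\in B$. Then $$\dim_k(A)\ \geq\ \dim_k(B)+\dim_k(C)-1.$$
   Context: A proper homomorphic image of $C$ is a quotient $C/C_0$ with $C_0\neq 0$. *)

(* Defs.v *)
From mathcomp Require Export all_boot all_order all_algebra.

Set Implicit Arguments.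
Unset Strict Implicit.
Unset Printing Implicit Defensive.

(* Main.v *)
Require Import Defs.
From HB Require Import structures.
From mathcomp Require Import all_boot all_order all_algebra.
From mathcomp Require Import zify ring.
From Stdlib Require Import Classical.

(* Pairing C with itself by a dot product turns f into a trilinear form
   t : A * B * C -> k.  For X <= B and Y <= C let K(X, Y) be the set of a with
   t a X Y = 0, and call (X, Y) minimal when shrinking X or Y enlarges K(X, Y).
   The inequality dim K(X, Y) + dim X + dim Y <= dim A + 1 is proved for
   minimal (X, Y) by induction on dim X + dim Y.

   An atom a at hyperplanes (H, J) of (X, Y) lies in K(H, Y) and K(X, J) but
   not in K(X, Y); modulo K(X, Y) it is a rank one tensor, so it lies in
   K(X', Y') exactly when X' <= H or Y' <= J.  By minimality every H and every
   J carries an atom.  If some H is such that every J has an atom with another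
   partner, then (H, Y) is again minimal and induction applies; symmetrically
   for J.  Otherwise "being partners" is a bijection H <-> J.  Fix partners H, J.
   - If two other partner pairs (H1, J1), (H2, J2) have the same traces on H
     and on J, a combination of their atoms is in K(H, J) but not in K(H, Y),
     and induction applies to (H, J).
   - If not, let U be a hyperplane of H.  Among two hyperplanes J1, J2 with the
     same trace on J, at least one has a partner not containing U, which makes
     (U, J) minimal; the two other hyperplanes through U give two atoms which
     are independent modulo K(H, J), so dim K(U, J) >= dim K(X, Y) + 3. *)

Set Implicit Arguments.
Unset Strict Implicit.
Unset Printing Implicit Defensive.

Import GRing.Theory.
Local Open Scope ring_scope.

(** * Hyperplanes of a subspace and kernels of linear forms *)

Section Hyperplanes.
Variables (k : fieldType) (V : vectType k).
Implicit Types (H U X : {vspace V}) (phi : V -> k).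

(** Linearity of [phi] is not an argument, so [annihilator] can be defined for a bare function [t];
    the value is as expected once [scalar phi] holds. *)
Definition scalar_lfun phi : 'Hom(V, k^o) := linfun (phi : V -> k^o).

Lemma scalar_lfunE phi : scalar phi -> scalar_lfun phi =1 phi.
Proof.
move=> phi_lin v.
pose L := GRing.isLinear.Build k V k^o *:%R (phi : V -> k^o) phi_lin.
pose F : {linear V -> k^o} := HB.pack (phi : V -> k^o) L.
exact: (lfunE F).
Qed.

Lemma scalarD phi u v : scalar phi -> phi (u + v) = phi u + phi v.
Proof. by move=> phi_lin; have := phi_lin 1 u v; rewrite scale1r mul1r. Qed.

Lemma scalar0 phi : scalar phi -> phi 0 = 0.
Proof.
by move=> phi_lin; apply: (addrI (phi 0)); rewrite -scalarD // !addr0.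
Qed.

Lemma scalarZ phi c v : scalar phi -> phi (c *: v) = c * phi v.
Proof.
by move=> phi_lin; rewrite -[c *: v]addr0 phi_lin (scalar0 phi_lin) addr0.
Qed.

Definition hyperplane H X := (H <= X)%VS && (\dim X == (\dim H).+1).

Lemma hyperplane_sub H X : hyperplane H X -> (H <= X)%VS.
Proof. by case/andP. Qed.

Lemma hyperplane_dim H X : hyperplane H X -> \dim X = (\dim H).+1.
Proof. by case/andP=> _ /eqP. Qed.

Lemma hyperplane_proper H X : hyperplane H X -> ~~ (X <= H)%VS.
Proof.
by move=> hH; apply/negP => /dimvS; rewrite (hyperplane_dim hH) ltnn.
Qed.

Lemma hyperplane_subP H H' X :
  hyperplane H X -> hyperplane H' X -> (H <= H')%VS = (H == H').
Proof.
move=> hH hH'; rewrite eqEdim; case: (H <= H')%VS => //=.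
by have := hyperplane_dim hH; rewrite (hyperplane_dim hH') => -[->]; rewrite leqnn.
Qed.

Lemma dim_add_line U x : x \notin U -> \dim (U + <[x]>)%VS = (\dim U).+1.
Proof.
move=> xU; rewrite dimv_disjoint_sum ?dim_vline.
  by rewrite (_ : x != 0) ?addn1 //; apply: contraNneq xU => ->; rewrite mem0v.
apply/eqP; rewrite -subv0; apply/subvP => v /memv_capP[vU /vlineP[c vE]].
rewrite memv0 vE; have [->|c0] := eqVneq c 0; first by rewrite scale0r.
case/negP: xU; have -> : x = c^-1 *: v by rewrite vE scalerA mulVf // scale1r.
exact: memvZ.
Qed.

Lemma hyperplane_add_line U x : x \notin U -> hyperplane U (U + <[x]>)%VS.
Proof. by move=> xU; rewrite /hyperplane addvSl dim_add_line /=. Qed.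

Lemma hyperplane_decomp H X x v :
    hyperplane H X -> x \in X -> x \notin H -> v \in X ->
  exists c, exists2 h, h \in H & v = h + c *: x.
Proof.
move=> hH xX xH vX.
suff XE : X = (H + <[x]>)%VS.
  move: vX; rewrite XE => /memv_addP[h hH' [_ /vlineP[c ->] ->]].
  by exists c, h.
apply/esym/eqP; rewrite eqEdim subv_add (hyperplane_sub hH) -memvE xX.
by rewrite dim_add_line // (hyperplane_dim hH) leqnn.
Qed.

Lemma hyperplane_ker phi X x :
    scalar phi -> x \in X -> phi x != 0 ->
  exists2 H, hyperplane H X & {in X, forall v, (v \in H) = (phi v == 0)}.
Proof.
move=> phi_lin xX phix; pose f := scalar_lfun phi.
have fE := scalar_lfunE phi_lin.
exists (X :&: lker f)%VS; last first.
  by move=> v vX; rewrite memv_cap vX memv_ker fE.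
rewrite /hyperplane capvSl -(limg_ker_dim f X) -addn1 eqn_add2l eqn_leq.
have := dimvS (subvf (f @: X)); rewrite dimvf /dim /= => ->.
rewrite lt0n dimv_eq0; apply: contra phix => /eqP fX.
by have := memv_img f xX; rewrite fX memv0 fE.
Qed.

(** A complement [W] of [U + <[x]>] in [X] is added to [U]. *)
Lemma hyperplane_avoid U X x :
    (U <= X)%VS -> x \in X -> x \notin U ->
  exists H, [/\ hyperplane H X, (U <= H)%VS & x \notin H].
Proof.
move=> UX xX xU; pose W := (X :\: (U + <[x]>))%VS.
have UxX : (U + <[x]> <= X)%VS by rewrite subv_add UX.
have XE : ((U + W) + <[x]>)%VS = X.
  rewrite -addvA [(W + _)%VS]addvC addvA addvC addv_diff.
  by apply/addv_idPl.
have dimW : (\dim W + (\dim U).+1 = \dim X)%N.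
  by rewrite -(dim_add_line xU) -(dimv_cap_compl X (U + <[x]>)) (capv_idPr UxX) addnC.
have xUW : x \notin (U + W)%VS.
  apply/negP => xUW; have UWX : (U + W)%VS = X.
    by rewrite -[RHS]XE; apply/esym/addv_idPl.
  have [dimUW _] := dimv_add_leqif U W.
  by move: dimUW; rewrite UWX; lia.
exists (U + W)%VS; split; rewrite ?addvSl //.
by rewrite -[X in hyperplane _ X]XE hyperplane_add_line.
Qed.

Lemma hyperplane_exists U : (0 < \dim U)%N -> exists H, hyperplane H U.
Proof.
rewrite lt0n dimv_eq0 -vpick0 -memv0 => nz.
by have [H [hH _ _]] := hyperplane_avoid (sub0v U) (memv_pick U) nz; exists H.
Qed.

Lemma hyperplane_cap H H' U X :
    hyperplane H X -> hyperplane H' X -> H != H' -> hyperplane U H ->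
  (U <= H')%VS -> (H :&: H')%VS = U.
Proof.
move=> hH hH' HH' hU UH'; apply/esym/eqP; rewrite eqEdim subv_cap UH'.
rewrite (hyperplane_sub hU) /= -ltnS -(hyperplane_dim hU).
rewrite ltn_neqAle dimvS ?capvSl // andbT; apply: contra HH' => /eqP dimE.
have /eqP HE : (H :&: H')%VS == H by rewrite eqEdim capvSl dimE leqnn.
by rewrite -(hyperplane_subP hH hH') -HE capvSr.
Qed.

(** The quotient of [X] by [U] is a plane, which over any field has at least three lines: for [y] in
    [H], those of [y], [x] and [x + y]. *)
Lemma hyperplane_two_others H U X :
    hyperplane H X -> hyperplane U H ->
  exists H1 H2, [/\ hyperplane H1 X, hyperplane H2 X,
    [/\ H1 != H, H2 != H & H1 != H2] & (U <= H1)%VS /\ (U <= H2)%VS].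
Proof.
move=> hH hU.
have [x xX xH] := subvPn (hyperplane_proper hH).
have [y yH yU] := subvPn (hyperplane_proper hU).
have UH := subvP (hyperplane_sub hU); have HX := subvP (hyperplane_sub hH).
have UX := subv_trans (hyperplane_sub hU) (hyperplane_sub hH).
have hyp z : z \in X -> z \notin H -> hyperplane (U + <[z]>)%VS X.
  move=> zX zH; rewrite /hyperplane subv_add UX -memvE zX.
  rewrite dim_add_line ?(contra (UH z)) //.
  by rewrite (hyperplane_dim hH) (hyperplane_dim hU) /=.
have neqH z : z \notin H -> (U + <[z]>)%VS != H.
  by apply: contraNneq => <-; rewrite memvE addvSr.
have xyX : x + y \in X by rewrite memvD // HX.
have xyH : x + y \notin H.
  by apply: contra xH => /memvB/(_ yH); rewrite addrK.
exists (U + <[x]>)%VS, (U + <[x + y]>)%VS; rewrite !hyp //.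
split=> //; last by rewrite !addvSl.
split; rewrite ?neqH //; apply: contra (neqH _ xH) => /eqP E.
have hx := hyp x xX xH; have yx : y \in (U + <[x]>)%VS.
  have -> : y = (x + y) - x by rewrite addrC addKr.
  by rewrite memvB ?memvE ?addvSr // E addvSr.
have := contra (UH x) xH => xU.
rewrite eq_sym -(hyperplane_subP hH hx); apply/subvP => h.
by case/(hyperplane_decomp hU yH yU) => c [u uU ->];
  rewrite memvD ?memvZ // (subvP (addvSl _ _)).
Qed.

Lemma dimv_lt (U W : {vspace V}) v :
  (U <= W)%VS -> v \in W -> v \notin U -> (\dim U < \dim W)%N.
Proof.
move=> UW vW vU; rewrite ltn_neqAle dimvS // andbT; apply: contra vU => /eqP dimE.
by have /eqP-> : U == W by rewrite eqEdim UW dimE /=.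
Qed.

End Hyperplanes.

(** * Trilinear forms, annihilators and atoms *)

Definition trilinear (k : fieldType) (A B D : vectType k) (t : A -> B -> D -> k) :=
  [/\ forall x y, scalar (fun a => t a x y),
      forall a y, scalar (fun x => t a x y) & forall a x, scalar (t a x)].

Definition swap (A B D k : Type) (t : A -> B -> D -> k) a y x := t a x y.

(** This is K(X, Y); finitely many kernels, one for each pair of basis vectors, make it a subspace
    by construction. *)
Definition annihilator (k : fieldType) (A B D : vectType k)
    (t : A -> B -> D -> k) (X : {vspace B}) (Y : {vspace D}) : {vspace A} :=
  (\bigcap_(i < \dim X) \bigcap_(j < \dim Y)
     lker (scalar_lfun (fun a => t a (vbasis X)`_i (vbasis Y)`_j)))%VS.

Definition minimal_left (k : fieldType) (A B D : vectType k)
    (t : A -> B -> D -> k) (X : {vspace B}) (Y : {vspace D}) :=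
  forall X', (X' <= X)%VS -> X' != X ->
    ~~ (annihilator t X' Y <= annihilator t X Y)%VS.

Definition minimal (k : fieldType) (A B D : vectType k)
    (t : A -> B -> D -> k) (X : {vspace B}) (Y : {vspace D}) :=
  minimal_left t X Y /\ minimal_left (swap t) Y X.

(* Modulo the annihilator of [(X, Y)], an atom at [(X', Y')] is a rank one
   tensor [phi * psi] with [ker phi = X'] and [ker psi = Y']. *)
Record atom (k : fieldType) (A B D : vectType k) (t : A -> B -> D -> k)
    (X : {vspace B}) (Y : {vspace D}) X' Y' a : Prop := Atom {
  atom_l : hyperplane X' X;
  atom_r : hyperplane Y' Y;
  atom_annl : a \in annihilator t X' Y;
  atom_annr : a \in annihilator t X Y';
  atom_nann : a \notin annihilator t X Y }.

Lemma trilinear_swap (k : fieldType) (A B D : vectType k)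
  (t : A -> B -> D -> k) : trilinear t -> trilinear (swap t).
Proof. by case=> tA tB tD; split=> *; [exact: tA | exact: tD | exact: tB]. Qed.

(** * Rank one behaviour of atoms, and criteria for minimality *)

Section Annihilator.
Variables (k : fieldType) (A B D : vectType k) (t : A -> B -> D -> k).
Hypothesis t_lin : trilinear t.
Implicit Types (X H : {vspace B}) (Y J : {vspace D}).

Let tA x y : scalar (fun a => t a x y). Proof. by case: t_lin. Qed.
Let tB a y : scalar (fun x => t a x y). Proof. by case: t_lin. Qed.
Let tD a x : scalar (t a x). Proof. by case: t_lin. Qed.

Let tBD a x x' y : t a (x + x') y = t a x y + t a x' y.
Proof. exact: (scalarD _ _ (tB a y)). Qed.
Let tBZ c a x y : t a (c *: x) y = c * t a x y.
Proof. exact: (scalarZ _ _ (tB a y)). Qed.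
Let tDD a x y y' : t a x (y + y') = t a x y + t a x y'.
Proof. exact: (scalarD _ _ (tD a x)). Qed.
Let tDZ c a x y : t a x (c *: y) = c * t a x y.
Proof. exact: (scalarZ _ _ (tD a x)). Qed.

Lemma annihilatorP X Y a :
  reflect {in X & Y, forall x y, t a x y = 0} (a \in annihilator t X Y).
Proof.
apply: (iffP idP) => [aK x y xX yY|tXY0]; last first.
  rewrite memvE; apply/subv_bigcapP => i _; apply/subv_bigcapP => j _.
  rewrite -memvE memv_ker scalar_lfunE //.
  by rewrite tXY0 //; apply/vbasis_mem/mem_nth; rewrite size_tuple.
rewrite (coord_vbasis xX) (coord_vbasis yY).
rewrite (big_morph (fun x => t a x _) (fun u v => tBD a u v _) (scalar0 (tB a _))).
apply: big1 => i _; rewrite tBZ.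
rewrite (big_morph (t a _) (tDD a _) (scalar0 (tD a _))) big1 ?mulr0 // => j _.
rewrite tDZ; suff -> : t a (vbasis X)`_i (vbasis Y)`_j = 0 by rewrite mulr0.
move: aK; rewrite memvE => /subv_bigcapP/(_ i isT)/subv_bigcapP/(_ j isT).
by rewrite -memvE memv_ker scalar_lfunE // => /eqP.
Qed.

Lemma annihilatorPn X Y a :
  reflect (exists x y, [/\ x \in X, y \in Y & t a x y != 0])
          (a \notin annihilator t X Y).
Proof.
apply: (iffP idP) => [aK|[x [y [xX yY]]]]; last first.
  by apply: contra => /annihilatorP->.
apply: NNPP => H; case/negP: aK; apply/annihilatorP => x y xX yY.
by have [//|txy] := eqVneq (t a x y) 0; case: H; exists x, y.
Qed.

Lemma annihilatorS X X' Y Y' : (X' <= X)%VS -> (Y' <= Y)%VS ->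
  (annihilator t X Y <= annihilator t X' Y')%VS.
Proof.
move=> /subvP XX /subvP YY; apply/subvP => a /annihilatorP aK.
by apply/annihilatorP => x y xX yY; apply: aK; [exact: XX | exact: YY].
Qed.

(** Modulo [H] and [J], the pair ([x], [y]) spans everything, so [t a x y = 0] would put [a] in K(X,
    Y). *)
Lemma atom_neq0 X Y H J a x y : atom t X Y H J a ->
  x \in X -> x \notin H -> y \in Y -> y \notin J -> t a x y != 0.
Proof.
case=> hH hJ /annihilatorP aH /annihilatorP aJ aK xX xH yY yJ.
apply: contra aK => /eqP txy; apply/annihilatorP => u v uX vY.
have [c [h hh ->]] := hyperplane_decomp hH xX xH uX.
have [d [j jj vE]] := hyperplane_decomp hJ yY yJ vY.
rewrite tBD aH // add0r tBZ vE tDD tDZ txy aJ //.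
by rewrite mulr0 addr0 mulr0.
Qed.

Lemma atom_mem X Y H J a X' Y' : atom t X Y H J a ->
    (X' <= X)%VS -> (Y' <= Y)%VS ->
  (a \in annihilator t X' Y') = (X' <= H)%VS || (Y' <= J)%VS.
Proof.
move=> atm X'X Y'Y; apply/idP/orP => [|[S|S]]; last 2 first.
- exact: (subvP (annihilatorS S Y'Y)) (atom_annl atm).
- exact: (subvP (annihilatorS X'X S)) (atom_annr atm).
move/annihilatorP=> aK; apply/orP; apply: contraT; rewrite negb_or.
case/andP=> /subvPn[x xX' xH] /subvPn[y yY' yJ].
have := atom_neq0 atm (subvP X'X _ xX') xH (subvP Y'Y _ yY') yJ.
by rewrite aK ?eqxx.
Qed.

(** Some [a] in K(H, Y) lies outside K(X, Y). As [X] is [H] plus a line through [x], the form of [a]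
    is governed by [t a x], whose kernel in [Y] is the partner [J]. *)
Lemma atom_exists X Y H : minimal_left t X Y -> hyperplane H X ->
  exists J a, atom t X Y H J a.
Proof.
move=> minX hH; have HX : H != X.
  by apply: contraTneq (hyperplane_proper hH) => ->; rewrite subvv.
have [a aH aK] := subvPn (minX _ (hyperplane_sub hH) HX).
have [x [y [xX yY txy]]] := annihilatorPn _ _ _ aK.
have xH : x \notin H.
  by apply: contra txy => xH; apply/eqP; move/annihilatorP: aH; apply.
have [J hJ JE] := hyperplane_ker (tD a x) yY txy.
exists J, a; split=> //; apply/annihilatorP => u v uX vJ.
have vY := subvP (hyperplane_sub hJ) _ vJ.
have [c [h hh ->]] := hyperplane_decomp hH xX xH uX.
move/annihilatorP: aH => aH; rewrite tBD aH // add0r tBZ.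
by move: vJ; rewrite JE // => /eqP->; rewrite mulr0.
Qed.

Lemma minimal_leftP X Y :
    (forall H, hyperplane H X ->
      exists2 a, a \in annihilator t H Y & a \notin annihilator t X Y) ->
  minimal_left t X Y.
Proof.
move=> minH X' X'X X'nX.
have /subvPn[x xX xX'] : ~~ (X <= X')%VS.
  by apply: contra X'nX => XX'; rewrite eqEsubv X'X.
have [H [hH X'H xH]] := hyperplane_avoid X'X xX xX'.
have [a aH aK] := minH H hH; apply/subvPn; exists a => //.
exact: (subvP (annihilatorS X'H (subvv Y))).
Qed.

(** A proper subspace of [X1] lies in a hyperplane [H] of [X] not containing [X1]. By [atom_mem], an
    atom at [H] whose partner does not contain [Y1] shows that K grows. *)
Lemma minimal_left_restrict X Y X1 Y1 :
    (X1 <= X)%VS -> (Y1 <= Y)%VS ->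
    (forall H, hyperplane H X -> ~~ (X1 <= H)%VS ->
      exists J a, atom t X Y H J a /\ ~~ (Y1 <= J)%VS) ->
  minimal_left t X1 Y1.
Proof.
move=> X1X Y1Y atm X' X'X1 X'nX1.
have /subvPn[x xX1 xX'] : ~~ (X1 <= X')%VS.
  by apply: contra X'nX1 => XX'; rewrite eqEsubv X'X1.
have X'X := subv_trans X'X1 X1X.
have [H [hH X'H xH]] := hyperplane_avoid X'X (subvP X1X x xX1) xX'.
have X1H : ~~ (X1 <= H)%VS by apply/subvPn; exists x.
have [J [a [aHJ Y1J]]] := atm H hH X1H.
apply/subvPn; exists a; rewrite (atom_mem aHJ) ?X'H //.
by rewrite negb_or X1H.
Qed.

End Annihilator.

(** * Symmetry between the last two arguments *)

Section Swap.
Variables (k : fieldType) (A B D : vectType k) (t : A -> B -> D -> k).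
Hypothesis t_lin : trilinear t.
Implicit Types (X H : {vspace B}) (Y J : {vspace D}).

Lemma annihilator_swap X Y : annihilator (swap t) Y X = annihilator t X Y.
Proof.
apply/vspaceP => a; apply/(annihilatorP (trilinear_swap t_lin))/(annihilatorP t_lin).
  by move=> aK x y xX yY; exact: aK.
by move=> aK y x yY xX; exact: aK.
Qed.

Lemma atom_swap X Y H J a : atom t X Y H J a -> atom (swap t) Y X J H a.
Proof. by case=> *; split; rewrite ?annihilator_swap. Qed.

End Swap.

(** * Inductive steps for the dimension bound *)

Section Bound.
Variables (k : fieldType) (A B D : vectType k) (t : A -> B -> D -> k).
Hypothesis t_lin : trilinear t.
Implicit Types (X H : {vspace B}) (Y J : {vspace D}).

Let st_lin := trilinear_swap t_lin.

Definition bound X Y :=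
  (\dim (annihilator t X Y) + \dim X + \dim Y <= (dim A).+1)%N.

Lemma atom_swapE X Y H J a : atom (swap t) Y X J H a -> atom t X Y H J a.
Proof. exact: (atom_swap st_lin). Qed.

Lemma atom_exists_swap X Y J : minimal_left (swap t) Y X -> hyperplane J Y ->
  exists H a, atom t X Y H J a.
Proof.
move=> minY hJ; have [H [a aJH]] := atom_exists st_lin minY hJ.
by exists H, a; apply: atom_swapE.
Qed.

Lemma dim_annihilatorS X Y X' Y' a : (X' <= X)%VS -> (Y' <= Y)%VS ->
    a \in annihilator t X' Y' -> a \notin annihilator t X Y ->
  (\dim (annihilator t X Y) < \dim (annihilator t X' Y'))%N.
Proof. by move=> X'X Y'Y; apply: dimv_lt; exact: annihilatorS. Qed.

(** Passing from [X] to [H] costs one dimension, and an atom at [H] gives it back in K. The atoms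
    with a partner other than [H] keep the pair minimal on the [Y] side. *)
Lemma bound_step X Y H :
    minimal t X Y -> hyperplane H X ->
    (forall J, hyperplane J Y -> exists H' a, atom t X Y H' J a /\ H' != H) ->
    (minimal t H Y -> bound H Y) ->
  bound X Y.
Proof.
move=> [minX minY] hH atm IH; have HX := hyperplane_sub hH.
have [J [a aHJ]] := atom_exists t_lin minX hH.
have lt := dim_annihilatorS HX (subvv Y) (atom_annl aHJ) (atom_nann aHJ).
suff /IH : minimal t H Y by move: lt; rewrite /bound (hyperplane_dim hH); clear; lia.
split.
  apply: (minimal_left_restrict t_lin HX (subvv Y)) => H' hH' _.
  have [J' [a' aHJ']] := atom_exists t_lin minX hH'.
  by exists J', a'; split=> //; exact: hyperplane_proper (atom_r aHJ').
apply: (minimal_left_restrict st_lin (subvv Y) HX) => J' hJ' _.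
have [H' [a' [aHJ' neH]]] := atm _ hJ'.
exists H', a'; split; first exact: atom_swap.
by rewrite (hyperplane_subP hH (atom_l aHJ')) eq_sym.
Qed.

(** * The case where partnership of hyperplanes is one to one *)

Section Paired.
Variables (X : {vspace B}) (Y : {vspace D}).
Hypothesis XY_min : minimal t X Y.
Hypothesis atom_uniq_r : forall H J J' a a',
  atom t X Y H J a -> atom t X Y H J' a' -> J = J'.
Hypothesis atom_uniq_l : forall H H' J a a',
  atom t X Y H J a -> atom t X Y H' J a' -> H = H'.
Variables (H : {vspace B}) (J : {vspace D}) (a : A).
Hypothesis aHJ : atom t X Y H J a.

Let hH := atom_l aHJ.
Let hJ := atom_r aHJ.
Let HX := hyperplane_sub hH.
Let JY := hyperplane_sub hJ.

Lemma atom_restrict_r H' J' b : atom t X Y H' J' b -> H' != H -> ~~ (J <= J')%VS.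
Proof.
move=> bHJ' neH; rewrite (hyperplane_subP hJ (atom_r bHJ')).
apply: contra neH => /eqP JE; apply/eqP.
by apply: (atom_uniq_l bHJ'); rewrite -JE; exact: aHJ.
Qed.

Lemma atom_restrict_l H' J' b : atom t X Y H' J' b -> J' != J -> ~~ (H <= H')%VS.
Proof.
move=> bHJ' neJ; rewrite (hyperplane_subP hH (atom_l bHJ')).
apply: contra neJ => /eqP HE; apply/eqP.
by apply: (atom_uniq_r bHJ'); rewrite -HE; exact: aHJ.
Qed.

(** A hyperplane not containing [U] differs from [H], so by uniqueness its partner differs from [J]
    and cannot contain it. *)
Lemma minimal_restrict_l U : (U <= H)%VS -> minimal_left t U J.
Proof.
move=> UH; apply: (minimal_left_restrict t_lin (subv_trans UH HX) JY) => H' hH' UH'.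
have [J' [b bHJ']] := atom_exists t_lin XY_min.1 hH'.
exists J', b; split=> //; apply: (atom_restrict_r bHJ').
by apply: contraNneq UH' => ->.
Qed.

Lemma minimal_restrict_r W : (W <= J)%VS -> minimal_left (swap t) W H.
Proof.
move=> WJ; apply: (minimal_left_restrict st_lin (subv_trans WJ JY) HX) => J' hJ' WJ'.
have [H' [b bHJ']] := atom_exists_swap XY_min.2 hJ'.
exists H', b; split; first exact: atom_swap.
by apply: (atom_restrict_l bHJ'); apply: contraNneq WJ' => ->.
Qed.

(* Two atoms with the same restrictions to [H * J] are proportional there, so
   a combination of them vanishes on [H * J]; it does not vanish on [H * Y]. *)
Lemma bound_parallel H1 H2 J1 J2 a1 a2 :
    atom t X Y H1 J1 a1 -> atom t X Y H2 J2 a2 ->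
    H1 != H -> H1 != H2 ->
    (H :&: H1 = H :&: H2)%VS -> (J :&: J1 = J :&: J2)%VS ->
    (minimal t H J -> bound H J) ->
  bound X Y.
Proof.
move=> aHJ1 aHJ2 neH1 neH12 capH capJ IH.
have {}IH : bound H J.
  by apply: IH; split; [exact: minimal_restrict_l | exact: minimal_restrict_r].
have neJ12 : J1 != J2.
  apply: contra neH12 => /eqP E; apply/eqP.
  by apply: (atom_uniq_l aHJ1); rewrite E; exact: aHJ2.
have [x xH xH1] : exists2 x, x \in H & x \notin H1.
  by apply/subvPn; rewrite (hyperplane_subP hH (atom_l aHJ1)) eq_sym.
have [y yJ yJ1] : exists2 y, y \in J & y \notin J1.
  exact/subvPn/(atom_restrict_r aHJ1).
have [z zJ1 zJ2] : exists2 z, z \in J1 & z \notin J2.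
  by apply/subvPn; rewrite (hyperplane_subP (atom_r aHJ1) (atom_r aHJ2)).
have xX := subvP HX _ xH; have yY := subvP JY _ yJ.
have zY := subvP (hyperplane_sub (atom_r aHJ1)) _ zJ1.
have xH2 : x \notin H2.
  apply: contra xH1 => xH2; have : x \in (H :&: H1)%VS by rewrite capH memv_cap xH.
  by case/memv_capP.
have yJ2 : y \notin J2.
  apply: contra yJ1 => yJ2; have : y \in (J :&: J1)%VS by rewrite capJ memv_cap yJ.
  by case/memv_capP.
have t1 := atom_neq0 t_lin aHJ1 xX xH1 yY yJ1.
have t2 := atom_neq0 t_lin aHJ2 xX xH2 yY yJ2.
(* The coefficients make [b] vanish at ([x], [y]), the only pair that matters on [H] and [J] modulo
   the common traces. *)
pose b := t a2 x y *: a1 - t a1 x y *: a2.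
have [tA tB tD] := t_lin.
have bE u v : t b u v = t a2 x y * t a1 u v - t a1 x y * t a2 u v.
  by rewrite (tA u v) -scaleNr (scalarZ _ _ (tA u v)) mulNr.
have bHJ : b \in annihilator t H J.
  apply/(annihilatorP t_lin) => u v uH vJ; rewrite bE.
  have uX := subvP HX _ uH; have vY := subvP JY _ vJ.
  have [c [h hH1 uE]] := hyperplane_decomp (atom_l aHJ1) xX xH1 uX.
  have [d [j jJ1 vE]] := hyperplane_decomp (atom_r aHJ1) yY yJ1 vY.
  have hH2 : h \in H2.
    suff : h \in (H :&: H1)%VS by rewrite capH => /memv_capP[].
    by rewrite memv_cap hH1 andbT -(addrK (c *: x) h) -uE memvB ?memvZ.
  have jJ2 : j \in J2.
    suff : j \in (J :&: J1)%VS by rewrite capJ => /memv_capP[].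
    by rewrite memv_cap jJ1 andbT -(addrK (d *: y) j) -vE memvB ?memvZ.
  have tE a' H' J' : atom t X Y H' J' a' -> h \in H' -> j \in J' ->
      t a' u v = c * d * t a' x y.
    move=> aHJ' hH' jJ'.
    have /(annihilatorP t_lin) ann_l := atom_annl aHJ'.
    have /(annihilatorP t_lin) ann_r := atom_annr aHJ'.
    rewrite uE (scalarD _ _ (tB a' v)) ann_l // add0r (scalarZ _ _ (tB a' v)).
    rewrite vE (scalarD _ _ (tD a' x)) ann_r // add0r (scalarZ _ _ (tD a' x)).
    by rewrite mulrA.
  rewrite (tE _ _ _ aHJ1) // (tE _ _ _ aHJ2) //.
  by ring.
(* Since [z] lies in [J1] but not in [J2], only the [a2] term survives at ([x], [z]). *)
have bHY : b \notin annihilator t H Y.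
  apply/(annihilatorPn t_lin); exists x, z; split=> //.
  have /(annihilatorP t_lin) ann_r := atom_annr aHJ1.
  rewrite bE ann_r // mulr0 add0r oppr_eq0 mulf_neq0 //.
  exact: (atom_neq0 t_lin aHJ2).
(* The two dimensions lost are regained along the strict chain K(X, Y) < K(H, Y) < K(H, J). *)
have lt1 := dim_annihilatorS HX (subvv Y) (atom_annl aHJ) (atom_nann aHJ).
have lt2 := dim_annihilatorS (subvv H) JY bHJ bHY.
by move: IH lt1 lt2; rewrite /bound (hyperplane_dim hH) (hyperplane_dim hJ); clear; lia.
Qed.

(** Going to ([U], [J]) loses three dimensions, so K must gain three. Arguing by contradiction makes
    [bound_parallel] a source of distinct traces on [J]. *)
Lemma bound_codim2 U :
    hyperplane U H ->
    (minimal t H J -> bound H J) -> (minimal t U J -> bound U J) ->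
  bound X Y.
Proof.
move=> hU IH1 IH2; apply: NNPP => nbound.
have UH := hyperplane_sub hU; have UX := subv_trans UH HX.
(* Both [H1] and [H2] meet [H] exactly in [U], so equal traces on [J] would give the bound. *)
have cap_neq H1 H2 J1 J2 a1 a2 : atom t X Y H1 J1 a1 -> atom t X Y H2 J2 a2 ->
    H1 != H -> H2 != H -> H1 != H2 -> (U <= H1)%VS -> (U <= H2)%VS ->
    (J :&: J1)%VS != (J :&: J2)%VS.
  move=> aHJ1 aHJ2 ne1 ne2 ne12 UH1 UH2; apply/eqP => capJ; apply: nbound.
  apply: (bound_parallel aHJ1 aHJ2) => //.
  by rewrite !(hyperplane_cap hH _ _ hU) ?(atom_l aHJ1) ?(atom_l aHJ2) // eq_sym.
have {}IH1 : bound H J.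
  by apply: IH1; split; [exact: minimal_restrict_l | exact: minimal_restrict_r].
have {}IH2 : bound U J.
  apply: IH2; split; first exact: minimal_restrict_l.
  (* Of two hyperplanes through [W] other than [J], one has a partner not containing [U], and its
     atom is the witness: otherwise [cap_neq] would separate their traces on [J], which are both
     [W]. *)
  apply: (minimal_leftP st_lin) => W hW.
  have [J1 [J2 [hJ1 hJ2 [ne1 ne2 ne12] [WJ1 WJ2]]]] := hyperplane_two_others hJ hW.
  have [H1 [a1 aHJ1]] := atom_exists_swap XY_min.2 hJ1.
  have [H2 [a2 aHJ2]] := atom_exists_swap XY_min.2 hJ2.
  have good H' J' b : atom t X Y H' J' b -> J' != J -> (W <= J')%VS ->
      ~~ (U <= H')%VS ->
    exists2 b, b \in annihilator (swap t) W U & b \notin annihilator (swap t) J U.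
    move=> aHJ' neJ' WJ' UH'; exists b; rewrite (annihilator_swap t_lin).
      by rewrite (atom_mem t_lin aHJ') ?WJ' ?orbT //
        (subv_trans WJ' (hyperplane_sub (atom_r aHJ'))).
    by rewrite (atom_mem t_lin aHJ') // negb_or UH'
      (hyperplane_subP hJ (atom_r aHJ')) eq_sym.
  have [UH1|UH1] := boolP (U <= H1)%VS; last exact: good aHJ1 ne1 WJ1 UH1.
  have [UH2|UH2] := boolP (U <= H2)%VS; last exact: good aHJ2 ne2 WJ2 UH2.
  have H1H : H1 != H.
    by apply: contra ne1 => /eqP E; apply/eqP/(atom_uniq_r aHJ1); rewrite E; exact: aHJ.
  have H2H : H2 != H.
    by apply: contra ne2 => /eqP E; apply/eqP/(atom_uniq_r aHJ2); rewrite E; exact: aHJ.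
  have H12 : H1 != H2.
    by apply: contra ne12 => /eqP E; apply/eqP/(atom_uniq_r aHJ1); rewrite E; exact: aHJ2.
  have := cap_neq _ _ _ _ _ _ aHJ1 aHJ2 H1H H2H H12 UH1 UH2.
  by rewrite !(hyperplane_cap hJ _ _ hW) ?eqxx // eq_sym.
have [H1 [H2 [hH1 hH2 [ne1 ne2 ne12] [UH1 UH2]]]] := hyperplane_two_others hH hU.
have [J1 [a1 aHJ1]] := atom_exists t_lin XY_min.1 hH1.
have [J2 [a2 aHJ2]] := atom_exists t_lin XY_min.1 hH2.
have neJ := cap_neq _ _ _ _ _ _ aHJ1 aHJ2 ne1 ne2 ne12 UH1 UH2.
(* Two dimensions come from K(H, J) < [L] < K(U, J): [b] witnesses the first inclusion and [c] the
   second. *)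
have chain H' H'' J' J'' b c : atom t X Y H' J' b -> atom t X Y H'' J'' c ->
    H' != H -> H'' != H -> (U <= H')%VS -> (U <= H'')%VS ->
    ~~ (J :&: J' <= J'')%VS ->
    (\dim (annihilator t H J) + 2 <= \dim (annihilator t U J))%N.
  move=> aHJ' aHJ'' ne' ne'' UH' UH'' JJ'.
  have HH' : (H <= H')%VS = false.
    by rewrite (hyperplane_subP hH (atom_l aHJ')) eq_sym (negPf ne').
  have HH'' : (H <= H'')%VS = false.
    by rewrite (hyperplane_subP hH (atom_l aHJ'')) eq_sym (negPf ne'').
  have JJY : (J :&: J' <= Y)%VS := subv_trans (capvSl _ _) JY.
  pose L := (annihilator t U J :&: annihilator t H (J :&: J'))%VS.
  have lt1 : (\dim (annihilator t H J) < \dim L)%N.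
    apply: (dimv_lt (v := b)).
    - by rewrite subv_cap !annihilatorS ?subvv ?capvSl.
    - by rewrite memv_cap !(atom_mem t_lin aHJ') // UH' capvSr orbT.
    - by rewrite (atom_mem t_lin aHJ') // HH' (atom_restrict_r aHJ').
  have lt2 : (\dim L < \dim (annihilator t U J))%N.
    apply: (dimv_lt (v := c)); first exact: capvSl.
      by rewrite (atom_mem t_lin aHJ'') // UH''.
    rewrite memv_cap !(atom_mem t_lin aHJ'') // UH'' HH'' /=.
    exact: JJ'.
  by move: lt1 lt2; clear; lia.
(* The traces differ, so one of them is not contained in the other; this decides the order of the
   two atoms. *)
have le : (\dim (annihilator t H J) + 2 <= \dim (annihilator t U J))%N.
  have [JJ2|] := boolP (J :&: J1 <= J2)%VS; last exact: (chain _ _ _ _ _ _ aHJ1 aHJ2).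
  have [JJ1|] := boolP (J :&: J2 <= J1)%VS; last exact: (chain _ _ _ _ _ _ aHJ2 aHJ1).
  by case/negP: neJ; rewrite eqEsubv !subv_cap !capvSl JJ1 JJ2.
have lt := dim_annihilatorS HX (subvv Y) (atom_annl aHJ) (atom_nann aHJ).
have le' := dimvS (annihilatorS t_lin (subvv H) JY).
apply: nbound; move: IH2 le lt le'; rewrite /bound (hyperplane_dim hH).
by rewrite (hyperplane_dim hU) (hyperplane_dim hJ); clear; lia.
Qed.
End Paired.
End Bound.

(** * The induction on the sum of the dimensions *)

Section Induction.
Variables (k : fieldType) (A B D : vectType k) (t : A -> B -> D -> k).
Hypothesis t_lin : trilinear t.
Implicit Types (X H : {vspace B}) (Y J : {vspace D}).

Lemma bound_swap X Y : bound (swap t) Y X = bound t X Y.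
Proof. by rewrite /bound (annihilator_swap t_lin) addnAC. Qed.

Lemma minimal_bound X Y : minimal t X Y -> bound t X Y.
Proof.
have st_lin := trilinear_swap t_lin.
have [n le_n] := ubnP (\dim X + \dim Y); elim: n => // n IHn in X Y le_n *.
move=> XYmin; have [minX minY] := XYmin; apply: NNPP => nbound.
(* Since [bound_step] must fail at [H], some [J] has no partner other than [H]. *)
have uniq_l H : hyperplane H X ->
    exists2 J, hyperplane J Y & forall H' a, atom t X Y H' J a -> H' = H.
  move=> hH; apply: NNPP => none; apply: nbound.
  apply: (bound_step t_lin XYmin hH); last first.
    by apply: IHn; move: le_n; rewrite (hyperplane_dim hH); clear; lia.
  move=> J hJ; apply: NNPP => none'; apply: none; exists J => // H' a aHJ.
  by apply/eqP; apply: contraT => neH; case: none'; exists H', a.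
have uniq_r J : hyperplane J Y ->
    exists2 H, hyperplane H X & forall J' a, atom t X Y H J' a -> J' = J.
  move=> hJ; apply: NNPP => none; apply: nbound; rewrite -bound_swap.
  apply: (bound_step st_lin _ hJ); first by split.
    move=> H hH; apply: NNPP => none'; apply: none; exists H => // J' a aHJ.
    apply/eqP; apply: contraT => neJ; case: none'; exists J', a; split=> //.
    exact: atom_swap.
  rewrite bound_swap => -[minJ minX']; apply: IHn; last by split.
  by move: le_n; rewrite (hyperplane_dim hJ); clear; lia.
(* Let [J] have [H] as sole possible partner, and let [H0] be a hyperplane whose sole possible
   partner is [J]. An atom at [H0] is then an atom at ([H0], [J]), which forces [H0 = H]. *)
have match_l H : hyperplane H X -> exists J, 
    (exists a, atom t X Y H J a) /\ (forall H' a, atom t X Y H' J a -> H' = H)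
    /\ (forall J' a, atom t X Y H J' a -> J' = J).
  move=> hH; have [J hJ JH] := uniq_l H hH.
  have [H0 hH0 H0J] := uniq_r J hJ.
  have [J0 [a aHJ]] := atom_exists t_lin minX hH0.
  have E := H0J _ _ aHJ; rewrite {}E in aHJ; have E := JH _ _ aHJ.
  by rewrite {}E in aHJ H0J; exists J; split; [exists a | split].
have atom_uniq_r H J J' a a' : atom t X Y H J a -> atom t X Y H J' a' -> J = J'.
  move=> aHJ aHJ'; have [J0 [_ [_ J0E]]] := match_l H (atom_l aHJ).
  by rewrite (J0E _ _ aHJ) (J0E _ _ aHJ').
have atom_uniq_l H H' J a a' : atom t X Y H J a -> atom t X Y H' J a' -> H = H'.
  move=> aHJ aHJ'; have [J0 [_ [J0l J0r]]] := match_l H (atom_l aHJ).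
  by rewrite (J0r _ _ aHJ) in aHJ'; rewrite (J0l _ _ aHJ').
have dimY0 : \dim X = 0%N -> \dim Y = 0%N.
  move=> dimX; apply/eqP; rewrite -leqn0 leqNgt; apply/negP => /hyperplane_exists[J hJ].
  by have [H [a /atom_l/hyperplane_dim]] := atom_exists_swap t_lin minY hJ; rewrite dimX.
have dimA X' Y' : (\dim (annihilator t X' Y') <= dim A)%N by rewrite -dimvf dimvS ?subvf.
have [dimX|dimX] := posnP (\dim X).
  by apply: nbound; rewrite /bound dimX (dimY0 dimX) !addn0 leqW.
have [H hH] := hyperplane_exists dimX.
have [J [a aHJ]] := atom_exists t_lin minX hH; have hJ := atom_r aHJ.
have [dimH|dimH] := posnP (\dim H); last first.
  have [U hU] := hyperplane_exists dimH.
  apply: nbound; apply: (bound_codim2 t_lin XYmin atom_uniq_r atom_uniq_l aHJ hU).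
    by apply: IHn; move: le_n; rewrite (hyperplane_dim hH) (hyperplane_dim hJ); clear; lia.
  apply: IHn; move: le_n.
  by rewrite (hyperplane_dim hH) (hyperplane_dim hJ) (hyperplane_dim hU); clear; lia.
(* Here [X] is a line. If [Y] is one too, the strict growth of K suffices; otherwise [Y] has several
   hyperplanes, which would all be paired with the only hyperplane 0 of [X]. *)
have [dimJ|dimJ] := posnP (\dim J).
  have lt := dim_annihilatorS t_lin (hyperplane_sub hH) (subvv Y)
    (atom_annl aHJ) (atom_nann aHJ).
  apply: nbound; move: lt (dimA H Y).
  by rewrite /bound (hyperplane_dim hH) (hyperplane_dim hJ) dimH dimJ; clear; lia.
have [W hW] := hyperplane_exists dimJ.
have [J1 [_ [hJ1 _ [ne1 _ _] _]]] := hyperplane_two_others hJ hW.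
have [H1 [a1 aHJ1]] := atom_exists_swap t_lin minY hJ1.
have H1E : H1 = H.
  apply/eqP; rewrite eqEdim.
  have := hyperplane_dim (atom_l aHJ1); rewrite (hyperplane_dim hH) dimH => -[d1].
  by rewrite -d1 leq0n andbT; have/eqP := esym d1; rewrite dimv_eq0 => /eqP->; rewrite sub0v.
rewrite {}H1E in aHJ1; case/eqP: ne1; exact: atom_uniq_r aHJ1 aHJ.
Qed.
End Induction.

(** * From the bilinear map to a trilinear form *)

Lemma common_zero (k : fieldType) (V : vectType k) m (phi : 'I_m -> V -> k) :
    (forall i, scalar (phi i)) -> (m < \dim {:V})%N ->
  exists2 v, v != 0 & forall i, phi i v = 0.
Proof.
move=> phi_lin ltm; pose g v : 'rV[k]_m := \row_i phi i v.
have g_lin : linear g by move=> c u v; apply/rowP => i; rewrite !mxE phi_lin.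
pose G : {linear V -> 'rV[k]_m} := HB.pack g (GRing.isLinear.Build k V _ *:%R g g_lin).
have ker0 : lker (linfun G) != 0%VS.
  apply: contraTneq ltm => ker0; have := limg_ker_dim (linfun G) fullv.
  rewrite ker0 capv0 dimv0 add0n -leqNgt => <-.
  by apply: leq_trans (dimvS (subvf _)) _; rewrite dimvf dim_matrix; apply: eq_leq; exact: mul1n.
exists (vpick (lker (linfun G))); first by rewrite vpick0.
move=> i; have := memv_pick (lker (linfun G)); rewrite memv_ker lfunE => /eqP/rowP/(_ i).
by rewrite !mxE.
Qed.

Theorem corollary2 (k : fieldType) (A B C : vectType k)
    (f : {bilinear A -> B -> C})
    (f_nondeg : forall a : A, a != 0 -> exists b : B, f a b != 0)
    (B_min : forall B0 : {vspace B}, B0 != fullv ->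
       exists2 a : A, a != 0 & forall b : B, b \in B0 -> f a b = 0)
    (C_min : forall C0 : {vspace C}, C0 != 0%VS ->
       exists2 a : A, a != 0 & forall b : B, f a b \in C0) :
  (\dim {:B})%:Z + (\dim {:C})%:Z - 1 <= (\dim {:A})%:Z.
Proof.
pose e := vbasis {:C}.
(* Only nondegeneracy of this pairing matters; isotropic vectors are harmless. *)
pose dot (c d : C) : k := \sum_i coord e i c * coord e i d.
pose t a b d := dot (f a b) d.
have dotC c d : dot c d = dot d c by apply: eq_bigr => i _; rewrite mulrC.
have dotr c : scalar (dot c).
  move=> z u v; rewrite /dot mulr_sumr -big_split; apply: eq_bigr => i _ /=.
  by rewrite linearP mulrDr mulrCA.
have dotl d : scalar (dot^~ d) by move=> z u v; rewrite !(dotC _ d) dotr.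
have dot_nondeg c : c != 0 -> exists d, dot c d != 0.
  move=> c0; apply: NNPP => nd; case/eqP: c0.
  rewrite (coord_vbasis (memvf c)) big1 // => i _.
  have <- : dot c e`_i = coord e i c.
    rewrite /dot (bigD1 i) //= coord_free ?(basis_free (vbasisP _)) // eqxx mulr1.
    rewrite big1 ?addr0 // => j ji.
    by rewrite coord_free ?(basis_free (vbasisP _)) // eq_sym (negPf ji) mulr0.
  have [->|dc] := eqVneq (dot c e`_i) 0; first by rewrite scale0r.
  by case: nd; exists e`_i.
have t_lin : trilinear t.
  split=> [b d c a a'|a d c b b'|a b]; last exact: dotr.
    by rewrite /t linearPl /= dotl.
  by rewrite /t linearPr /= dotl.
have annE : annihilator t fullv fullv = 0%VS.
  apply/eqP; rewrite -subv0; apply/subvP => a /(annihilatorP t_lin) aK.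
  rewrite memv0; apply: contraT => /f_nondeg[b /dot_nondeg[d]].
  by rewrite -/(t a b d) aK ?memvf ?eqxx.
have nann a : a != 0 -> a \notin annihilator t fullv fullv by rewrite annE memv0.
have t_min : minimal t fullv fullv.
  split=> [B0 _ /B_min[a a0 aB0]|D0 _ D0n].
    apply/subvPn; exists a; last exact: nann.
    by apply/(annihilatorP t_lin) => b d /aB0 ab _; rewrite /t ab (scalar0 (dotl d)).
  have ltD0 : (\dim D0 < \dim {:C})%N.
    by rewrite ltn_neqAle dimvS ?subvf // andbT (dimv_leqif_eq (subvf D0)).2.
  (* A nonzero [c] orthogonal to [D0] exists by dimension. Applying [C_min] to the line of [c] gives
     an [a] whose values [f a b] are all orthogonal to [D0]. *)
  have [c c0 cD0] := common_zero (fun i : 'I_(\dim D0) => dotl (vbasis D0)`_i) ltD0.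
  have /C_min[a a0 aC0] : <[c]>%VS != 0%VS by rewrite -dimv_eq0 dim_vline c0.
  apply/subvPn; exists a; rewrite annihilator_swap //; last exact: nann.
  apply/(annihilatorP t_lin) => b d _ dD0; rewrite /t.
  have /vlineP[z ->] := aC0 b; rewrite (scalarZ _ _ (dotl d)).
  rewrite (coord_vbasis dD0).
  rewrite (big_morph (dot c) (fun u v => scalarD u v (dotr c)) (scalar0 (dotr c))).
  by rewrite big1 ?mulr0 // => i _; rewrite (scalarZ _ _ (dotr c)) cD0 mulr0.
have := minimal_bound t_lin t_min.
rewrite /bound annE dimv0 !dimvf; clear; lia.
Qed.
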